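(* Let $G$ be a disconnected finite simple graph of order $n$ with no connected component of order less than $3$, such that every bipartite connected component has both color classes of even order. Let $s=n+1$ if $n\equiv 2\pmod 4$ and $s=n$ otherwise. Then for every integer $t\geq s$ and every Abelian group $\mathcal{G}$ of order $t$ having at most one element $i$ with $i\neq 0=2i$, there exists a $\mathcal{G}$-irregular labeling of $G$.
   Context: For an Abelian group $\mathcal{G}$ (written additively) and an edge labeling $f:E(G)\rightarrow\mathcal{G}$, the weighted degree of a vertex $v$ is $w(v)=\sum_{u\in N(v)} f(uv)$ (sum in $\mathcal{G}$). The labeling $f$ is called $\mathcal{G}$-irregular if all weighted degrees are pairwise distinct. *)

(* Defs.v *)
From HB Require Import structures.
From mathcomp Require Import all_boot all_algebra.

Set Implicit Arguments.
Unset Strict Implicit.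
Unset Printing Implicit Defensive.

Import GRing.Theory.

Definition simple_graph (T : finType) (e : rel T) : Prop :=
  symmetric e /\ irreflexive e.

Definition neighbors (T : finType) (e : rel T) (v : T) : {set T} :=
  [set u | e v u].

Definition components (T : finType) (e : rel T) : {set {set T}} :=
  [set [set y | connect e x y] | x : T].

Definition disconnected_graph (T : finType) (e : rel T) : Prop :=
  1 < #|components e|.

(* [A] and [B] are the color classes of a proper 2-coloring of the subgraph
   induced on [C]; when [C] is a component of order at least 2, the pair is
   unique up to exchanging [A] and [B]. *)
Definition bipartition (T : finType) (e : rel T) (C A B : {set T}) : Prop :=
  [/\ A :|: B = C, [disjoint A & B],
      {in A &, forall x y, ~~ e x y} & {in B &, forall x y, ~~ e x y}].

Section Labelings.

Variables (T : finType) (e : rel T) (gT : finZmodType).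

(* The edge uv is the pair [set u; v], so an edge labeling is a function on
   {set T}; only its values on edges are ever used. *)
Definition wdeg (f : {set T} -> gT) (v : T) : gT :=
  (\sum_(u in neighbors e v) f [set u; v])%R.

Definition irregular_labeling (f : {set T} -> gT) : Prop :=
  injective (wdeg f).

End Labelings.

Definition order_bound (n : nat) : nat := if n == 2 %[mod 4] then n.+1 else n.

Definition at_most_one_involution (gT : finZmodType) : Prop :=
  forall i j : gT,
    (i != 0 -> i *+ 2 = 0 -> j != 0 -> j *+ 2 = 0 -> i = j)%R.

(* Main.v *)
(* Labeling the edges of a walk alternately by x and -x changes only the weights
   of its ends: an even walk from u to v adds x at u and -x at v, and an odd
   closed walk at v adds 2x at v.  Call two vertices equivalent when an even walk
   joins them; the classes are the color classes of the bipartite components and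
   the whole non-bipartite components.  So an odd class is a non-bipartite
   component: remove one vertex from each of them, pair the remaining vertices
   inside their classes, and give the two vertices of a pair opposite weights
   x, -x with 2x <> 0.  The removed vertices receive distinct elements of 2G,
   taken in opposite pairs up to a single 0; there are at most n/3 of them, so
   2G, of index at most 2, is large enough.  Parity leaves only the case n = t
   divisible by 4, where the weights 0 and i (the involution) must be used.  Then
   i = 2g for some g; 0 and i go to one non-bipartite component if there is one,
   and otherwise a bipartite component gets 0, g in one color class and 2g, -g in
   the other, both with sum g. *)

Require Import Defs.
From HB Require Import structures.
From mathcomp Require Import all_boot all_algebra.
From mathcomp Require Import zify.

Set Implicit Arguments.
Unset Strict Implicit.
Unset Printing Implicit Defensive.

Import GRing.Theory.

(** * Walks of even and odd length, and the classes of vertices joined by even walks *)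

Section EvenWalks.

Variables (T : finType) (e : rel T).
Hypothesis e_sym : symmetric e.

(** Even walks are connectivity for the square of [e]: no lengths are tracked, and the canonical
    roots of connectivity classes become available. *)
Definition two_step : rel T := [rel u v | [exists m, e u m && e m v]].
Definition even_walk : rel T := connect two_step.
Definition odd_walk : rel T := [rel u v | [exists m, e u m && even_walk m v]].
Definition even_class (v : T) : {set T} := [set u | even_walk v u].

Lemma two_step_sym : symmetric two_step.
Proof.
move=> u v; apply/existsP/existsP => -[m /andP[um mv]]; exists m;
  by rewrite e_sym mv e_sym um.
Qed.

Lemma even_walk_refl : reflexive even_walk.
Proof. exact: connect0. Qed.

Lemma even_walk_sym : symmetric even_walk.
Proof. exact: sym_connect_sym two_step_sym. Qed.

Lemma even_walk_trans : transitive even_walk.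
Proof. exact: connect_trans. Qed.

Lemma even_walk_left_trans : left_transitive even_walk.
Proof. exact: same_connect even_walk_sym. Qed.

Lemma even_walk2 u m v : e u m -> e m v -> even_walk u v.
Proof. by move=> um mv; apply: connect1; apply/existsP; exists m; rewrite um. Qed.

(** Shifting the walk by one edge moves its odd edge from the front to the back; this makes
    [odd_walk], defined with the odd edge first, symmetric. *)
Lemma edge_even_walk u v w : e u v -> even_walk v w ->
  exists2 m, even_walk u m & e m w.
Proof.
move=> uv /connectP[p]; elim: p u v uv => [|a p IH] u v uv /=.
  by move=> _ ->; exists u => //; apply: connect0.
case/andP=> /existsP[m /andP[vm ma]] pth lst.
have [m' mm' m'w] := IH m a ma pth lst.
by exists m' => //; apply: even_walk_trans mm'; apply: even_walk2 uv vm.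
Qed.

Lemma odd_walk_sym u v : odd_walk u v -> odd_walk v u.
Proof.
case/existsP=> m /andP[um mv]; have [m' um' m'v] := edge_even_walk um mv.
by apply/existsP; exists m'; rewrite e_sym m'v even_walk_sym.
Qed.

Lemma odd_even_walk u v w : odd_walk u v -> even_walk v w -> odd_walk u w.
Proof.
case/existsP=> m /andP[um mv] vw.
by apply/existsP; exists m; rewrite um (even_walk_trans mv).
Qed.

Lemma odd_walk_edge u v w : odd_walk u v -> e v w -> even_walk u w.
Proof.
case/existsP=> m /andP[um mv] vw.
have [m' um' m'v] := edge_even_walk um mv.
exact: even_walk_trans um' (even_walk2 m'v vw).
Qed.

Lemma even_odd_walk u v w : even_walk u v -> odd_walk v w -> odd_walk u w.
Proof.
move=> uv vw; apply: odd_walk_sym; apply: odd_even_walk (odd_walk_sym vw) _.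
by rewrite even_walk_sym.
Qed.

Lemma odd_odd_walk u v w : odd_walk u v -> odd_walk v w -> even_walk u w.
Proof.
move=> uv /existsP[m /andP[vm mw]].
exact: even_walk_trans (odd_walk_edge uv vm) mw.
Qed.

Lemma edge_odd_walk u v : e u v -> odd_walk u v.
Proof. by move=> uv; apply/existsP; exists v; rewrite uv even_walk_refl. Qed.

Lemma even_walk_connect u v : even_walk u v -> connect e u v.
Proof.
apply: connect_sub => a b /existsP[m /andP[am mb]].
exact: connect_trans (connect1 am) (connect1 mb).
Qed.

Lemma connect_even_or_odd u v : connect e u v -> even_walk u v \/ odd_walk u v.
Proof.
case/connectP=> p; elim/last_ind: p v => [|p a IH] v /=.
  by move=> _ ->; left; apply: connect0.
rewrite rcons_path last_rcons => /andP[pth la] ->.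
case: (IH _ pth erefl) => w; last by left; apply: odd_walk_edge w la.
by right; apply: even_odd_walk w (edge_odd_walk la).
Qed.

(** An edge inside the class would close an odd walk at [v]; the other vertices of the component are
    reached by odd walks, so an edge between two of them would pull one into the class. *)
Lemma even_class_bipartition v : ~~ odd_walk v v ->
  bipartition e [set y | connect e v y] (even_class v)
    ([set y | connect e v y] :\: even_class v).
Proof.
move=> nvv; split.
- rewrite -[RHS](setID _ (even_class v)); congr (_ :|: _).
  apply/esym/setIidPr/subsetP=> y; rewrite !inE; exact: even_walk_connect.
- by rewrite disjoint_sym disjoints_subset setDE subsetIr.
- move=> x y; rewrite !inE => vx vy; apply/negP=> xy; case/negP: nvv.
  apply: even_odd_walk vx (odd_even_walk (edge_odd_walk xy) _).
  by rewrite even_walk_sym.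
- move=> x y; rewrite !inE => /andP[nx vx] /andP[ny vy]; apply/negP=> xy.
  have [vx'|vx'] := connect_even_or_odd vx; first by rewrite vx' in nx.
  by rewrite (odd_walk_edge vx' xy) in ny.
Qed.

End EvenWalks.

(** * Vertex weights realized by edge labelings *)

Section Weights.

Variables (T : finType) (e : rel T) (gT : finZmodType).
Hypotheses (e_sym : symmetric e) (e_irr : irreflexive e).

Local Open Scope ring_scope.

Definition realizable (w : {ffun T -> gT}) : Prop :=
  exists f : {set T} -> gT, forall v, wdeg e f v = w v.

Definition point_weight (u : T) (x : gT) : {ffun T -> gT} :=
  [ffun v => if v == u then x else 0].

Lemma realizable0 : realizable 0.
Proof.
by exists (fun=> 0) => v; rewrite ffunE /wdeg big1.
Qed.

Lemma realizableD w1 w2 : realizable w1 -> realizable w2 -> realizable (w1 + w2).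
Proof.
move=> [f1 h1] [f2 h2]; exists (fun A => f1 A + f2 A) => v.
by rewrite ffunE -h1 -h2 /wdeg big_split.
Qed.

Lemma point_weight0 u : point_weight u 0 = 0.
Proof. by apply/ffunP=> v; rewrite !ffunE if_same. Qed.

Lemma point_weightD u x y :
  point_weight u (x + y) = point_weight u x + point_weight u y.
Proof. by apply/ffunP=> v; rewrite !ffunE; case: eqP; rewrite ?addr0. Qed.

Lemma realizable_edge u v x : e u v ->
  realizable (point_weight u x + point_weight v x).
Proof.
move=> uv; have nuv : u != v by apply: contraTneq uv => ->; rewrite e_irr.
exists (fun A => if A == [set u; v] then x else 0) => z.
have edgeE y : ([set y; z] == [set u; v]) =
    (z == u) && (y == v) || (z == v) && (y == u).
  apply/eqP/idP=> [yz|/orP[]/andP[/eqP-> /eqP->] //]; last by rewrite setUC.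
  have: z \in [set u; v] by rewrite -yz !inE eqxx orbT.
  have: u \in [set y; z] by rewrite yz !inE eqxx.
  have: v \in [set y; z] by rewrite yz !inE eqxx orbT.
  rewrite !inE => vyz uyz /orP[]/eqP zE; rewrite zE eqxx in vyz uyz *.
    by move: vyz; rewrite (eq_sym v u) (negPf nuv) orbF eq_sym => ->.
  by move: uyz; rewrite (negPf nuv) orbF eq_sym => ->; rewrite orbT.
rewrite /wdeg !ffunE; under eq_bigr do rewrite edgeE.
have [->|nzu] := eqVneq z u.
  rewrite (negPf nuv) addr0 (bigD1 v) ?inE //= eqxx big1 ?addr0 // => y.
  by case/andP=> _ /negPf->.
have [->|nzv] /= := eqVneq z v.
  rewrite add0r (bigD1 u) ?inE ?(e_sym v) //= eqxx big1 ?addr0 // => y.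
  by case/andP=> _ /negPf->.
by rewrite addr0 big1.
Qed.

Lemma realizable_even u v x : even_walk e u v ->
  realizable (point_weight u x + point_weight v (- x)).
Proof.
case/connectP=> p; elim: p u => [|a p IH] u /=.
  by move=> _ ->; rewrite -point_weightD subrr point_weight0; apply: realizable0.
case/andP=> /existsP[m /andP[um ma]] pth lst.
(* The labels [x] on [um] and [- x] on [ma] cancel at [m], and the [- x] left at [a] cancels against
   the induction hypothesis. *)
have := realizableD (realizableD (realizable_edge x um) (realizable_edge (- x) ma))
  (IH a pth lst).
congr realizable; rewrite !addrA -(addrA (point_weight u x)) -point_weightD.
by rewrite subrr point_weight0 addr0 -(addrA (point_weight u x)) -point_weightD
  addNr point_weight0 addr0.
Qed.

Lemma realizable_odd u v x : odd_walk e u v ->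
  realizable (point_weight u x + point_weight v x).
Proof.
case/existsP=> m /andP[um mv].
have := realizableD (realizable_edge x um) (realizable_even (- x) mv).
rewrite opprK addrA -(addrA (point_weight u x)) -point_weightD subrr.
by rewrite point_weight0 addr0.
Qed.

Lemma realizable_double u x : odd_walk e u u -> realizable (point_weight u (x *+ 2)).
Proof. by rewrite mulr2n point_weightD; apply: realizable_odd. Qed.

(** [F] is a stock of weights reserved for [V], possibly larger than what [V] uses. Vanishing
    outside [V] lets weightings with disjoint vertex sets and disjoint stocks be added. *)
Definition partial_weighting (V : {set T}) (F : {set gT}) (w : {ffun T -> gT}) :=
  [/\ realizable w, {in V &, injective w}, {in V, forall v, w v \in F} &
      {in ~: V, forall v, w v = 0}].

Lemma partial_weighting0 F : partial_weighting set0 F 0.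
Proof.
by split=> [|u v|v|v _]; rewrite ?inE ?ffunE //; apply: realizable0.
Qed.

Lemma partial_weightingU (V1 V2 : {set T}) (F1 F2 : {set gT}) w1 w2 :
    [disjoint V1 & V2] -> [disjoint F1 & F2] ->
    partial_weighting V1 F1 w1 -> partial_weighting V2 F2 w2 ->
  partial_weighting (V1 :|: V2) (F1 :|: F2) (w1 + w2).
Proof.
move=> dV dF [r1 i1 m1 z1] [r2 i2 m2 z2].
have E1 v : v \in V1 -> (w1 + w2) v = w1 v.
  by move=> v1; rewrite ffunE z2 ?addr0 // inE (disjointFr dV v1).
have E2 v : v \in V2 -> (w1 + w2) v = w2 v.
  by move=> v2; rewrite ffunE z1 ?add0r // inE (disjointFl dV v2).
split; first exact: realizableD.
- move=> u v; rewrite !inE => /orP[] uV /orP[] vV.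
  + by rewrite !E1 //; apply: i1.
  + rewrite E1 // E2 // => E.
    by move: (m1 _ uV); rewrite E (disjointFl dF (m2 _ vV)).
  + rewrite E2 // E1 // => E.
    by move: (m2 _ uV); rewrite E (disjointFr dF (m1 _ vV)).
  + by rewrite !E2 //; apply: i2.
- move=> v; rewrite !inE => /orP[] vV; first by rewrite E1 ?m1.
  by rewrite E2 ?m2 ?orbT.
- move=> v; rewrite !inE negb_or => /andP[v1 v2].
  by rewrite ffunE z1 ?z2 ?inE ?addr0.
Qed.

Lemma partial_weighting_pair u v x : u != v -> x != - x ->
    realizable (point_weight u x + point_weight v (- x)) ->
  partial_weighting [set u; v] [set x; - x]
    (point_weight u x + point_weight v (- x)).
Proof.
move=> nuv nx r; set w := (_ + _).
have wu : w u = x by rewrite !ffunE eqxx (negPf nuv) addr0.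
have wv : w v = - x by rewrite !ffunE eqxx eq_sym (negPf nuv) add0r.
split=> //.
- move=> a b; rewrite !inE => /orP[] /eqP-> /orP[] /eqP->; rewrite ?wu ?wv //.
    by move/eqP; rewrite (negPf nx).
  by move/eqP; rewrite eq_sym (negPf nx).
- by move=> a; rewrite !inE => /orP[] /eqP->; rewrite ?wu ?wv eqxx ?orbT.
- move=> a; rewrite !inE negb_or => /andP[/negPf na /negPf nb].
  by rewrite !ffunE na nb addr0.
Qed.

(** * Sets of group elements closed under opposites, and the basic pairing argument *)

Definition opp_closed (P : {set gT}) := {in P, forall x, - x \in P}.
Definition two_torsion : {set gT} := [set x | x *+ 2 == 0].

Lemma two_torsionE x : (x \in two_torsion) = (x == - x).
Proof. by rewrite inE mulr2n addr_eq0. Qed.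

Lemma opp_closedC P : opp_closed P -> opp_closed (~: P).
Proof. by move=> cP x; rewrite !inE; apply: contra => /cP; rewrite opprK. Qed.

Lemma opp_closedD P Q : opp_closed P -> opp_closed Q -> opp_closed (P :\: Q).
Proof.
move=> cP /opp_closedC cQ x; rewrite !inE => /andP[nQ /cP->].
by have:= cQ x; rewrite !inE nQ => ->.
Qed.

Lemma opp_closedD2 P x : opp_closed P -> opp_closed (P :\ x :\ - x).
Proof.
move=> cP y; rewrite !inE => /and3P[ny nx /cP->].
by rewrite eqr_opp nx eqr_oppLR ny.
Qed.

(** Negation has no fixed point on [P], so [P] splits into pairs [x], [- x]. *)
Lemma card_opp_closed (P : {set gT}) : opp_closed P -> [disjoint P & two_torsion] ->
  ~~ odd #|P|.
Proof.
have [m] := ubnP #|P|; elim: m P => // m IH P ltPm cP dP.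
have [->|[x xP]] := set_0Vmem P; first by rewrite cards0.
have nx : x != - x by rewrite -two_torsionE (disjointFr dP xP).
have sub : P :\ x :\ - x \subset P by apply: subset_trans (subD1set _ _) (subD1set _ _).
have cE : #|P| = #|P :\ x :\ - x|.+2.
  by rewrite (cardsD1 x P) xP (cardsD1 (- x) (P :\ x)) !inE eq_sym nx (cP x xP).
rewrite cE /= negbK; apply: IH; last exact: disjointWl sub dP.
  by move: ltPm; rewrite cE; lia.
exact: opp_closedD2.
Qed.

(** Greedy: give two [r]-related vertices the weights [x] and [- x], then recurse on the rest. The
    relation is a parameter because it is used both with the total relation, for weights in 2G, and
    with [even_walk]. The exact size of [F] allows counting the weights left over. *)
Lemma paired_weighting (r : rel T) (V : {set T}) (P : {set gT}) :
    reflexive r -> left_transitive r ->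
    {in V, forall v, ~~ odd #|[set u in V | r v u]|} ->
    {in V &, forall u v, r u v -> {in P, forall x,
      realizable (point_weight u x + point_weight v (- x))}} ->
    opp_closed P -> [disjoint P & two_torsion] -> (#|V| <= #|P|)%N ->
  exists w, exists2 F : {set gT},
    [/\ F \subset P, opp_closed F & #|F| = #|V|] & partial_weighting V F w.
Proof.
move=> r_refl r_trans; have [m] := ubnP #|V|.
elim: m V P => // m IH V P ltVm evV rV cP dP leVP.
have [V0|[v vV]] := set_0Vmem V.
  exists 0, set0; last by rewrite V0; apply: partial_weighting0.
  by rewrite V0 sub0set !cards0; split=> // x; rewrite inE.
have [u uV /andP[vu nuv]] : exists2 u, u \in V & r v u && (v != u).
  have := evV v vV; rewrite (cardsD1 v) inE vV r_refl /=.
  case: (set_0Vmem ([set u in V | r v u] :\ v)) => [->|[u]]; first by rewrite cards0.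
  by rewrite !inE => /and3P[nu uV vu] _; exists u => //; rewrite vu eq_sym.
have [x xP] : exists x, x \in P.
  by apply/card_gt0P; apply: leq_trans leVP; apply/card_gt0P; exists v.
have nx : x != - x by rewrite -two_torsionE (disjointFr dP xP).
have subP : P :\ x :\ - x \subset P by apply: subset_trans (subD1set _ _) (subD1set _ _).
have cPE : #|P| = #|P :\ x :\ - x|.+2.
  by rewrite (cardsD1 x P) xP (cardsD1 (- x) (P :\ x)) !inE eq_sym nx (cP x xP).
have cVE : #|V| = #|V :\ v :\ u|.+2.
  by rewrite (cardsD1 v V) vV (cardsD1 u (V :\ v)) !inE eq_sym nuv uV.
have subV z : z \in V :\ v :\ u -> z \in V by rewrite !inE => /and3P[].
have [||||||w [F [sF cF cardF] pw]] := IH (V :\ v :\ u) (P :\ x :\ - x).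
- by move: ltVm; rewrite cVE; lia.
- move=> z zV; have -> : [set y in V :\ v :\ u | r z y] =
      [set y in V | r z y] :\ v :\ u by apply/setP=> y; rewrite !inE !andbA.
  have := evV z (subV z zV).
  rewrite (cardsD1 v [set y in V | r z y]) (cardsD1 u (_ :\ v)) !inE eq_sym nuv.
  (* The removed vertices are related, so the class of [z] loses both or neither and its parity is
     kept. *)
  rewrite vV uV /=; have -> : r z u = r z v.
    apply/idP/idP=> zz; last by rewrite (r_trans _ _ zz).
    by rewrite (r_trans _ _ zz) -(r_trans _ _ vu) r_refl.
  by rewrite !oddD addbA addbb.
- move=> a b aV bV rab y /(subsetP subP) yP.
  exact: rV (subV _ aV) (subV _ bV) rab y yP.
- exact: opp_closedD2.
- exact: disjointWl subP dP.
- by move: leVP; rewrite cVE cPE; lia.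
have dF : [disjoint [set x; - x] & F].
  rewrite -setI_eq0; apply/eqP/setP=> y; rewrite !inE.
  apply/negP=> /andP[yx /(subsetP sF)]; rewrite !inE => /and3P[y1 y2 _].
  by rewrite (negPf y1) (negPf y2) in yx.
exists (point_weight v x + point_weight u (- x) + w), ([set x; - x] :|: F).
  split.
  - rewrite subUset (subset_trans sF subP) andbT; apply/subsetP=> y.
    by rewrite !inE => /orP[]/eqP->; rewrite ?cP.
  - move=> y; rewrite !inE => /orP[/orP[]/eqP->|/cF->]; rewrite ?opprK ?eqxx ?orbT //.
  - by rewrite cardsU disjoint_setI0 // cards0 subn0 cards2 nx cardF cVE.
have -> : V = [set v; u] :|: (V :\ v :\ u).
  apply/setP=> y; rewrite !inE; have [->|] := eqVneq y v; first by rewrite vV.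
  by have [->|] := eqVneq y u; rewrite ?uV.
apply: partial_weightingU => //.
  rewrite -setI_eq0; apply/eqP/setP=> y; rewrite !inE.
  by have [_|_] := eqVneq y v; have [_|_] := eqVneq y u; rewrite ?andbF.
by apply: partial_weighting_pair => //; apply: rV.
Qed.

Definition doubles : {set gT} := [set x *+ 2 | x : gT].

Lemma opp_closed_two_torsion : opp_closed two_torsion.
Proof. by move=> x; rewrite !two_torsionE opprK eq_sym. Qed.

Lemma opp_closed_doubles : opp_closed doubles.
Proof.
by move=> _ /imsetP[x _ ->]; rewrite -mulNrn; apply/imsetP; exists (- x).
Qed.

Lemma zero_two_torsion : 0 \in two_torsion.
Proof. by rewrite inE mul0rn. Qed.

(** The fibres of doubling are the cosets of [two_torsion]. *)
Lemma card_doubles : #|gT| = (#|doubles| * #|two_torsion|)%N.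
Proof.
rewrite -[#|gT|]sum1_card (partition_big (fun x => x *+ 2) (mem doubles)) /=;
  last first.
  by move=> x _; apply: imset_f.
rewrite -sum_nat_const; apply: eq_bigr => y /imsetP[a _ ->].
rewrite sum1_card -(card_imset (mem two_torsion) (addrI a)).
apply: eq_card => x; rewrite [LHS]inE; apply/eqP/imsetP => [E|[z]].
  by exists (x - a); rewrite ?inE ?mulrnBl ?E ?subrr // addrC subrK.
by rewrite inE => /eqP z0 ->; rewrite mulrnDl z0 addr0.
Qed.

Lemma two_torsion_cases : at_most_one_involution gT ->
  two_torsion = [set 0] \/ exists2 i, i != 0 & two_torsion = [set 0; i].
Proof.
move=> inv; have [E|[i]] := set_0Vmem (two_torsion :\ 0).
  by left; rewrite -(setD1K zero_two_torsion) E setU0.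
rewrite !inE => /andP[ni /eqP i2]; right; exists i => //.
apply/setP=> x; rewrite !inE; have [->|nx] := eqVneq x 0; first by rewrite mul0rn eqxx.
by apply/eqP/eqP=> [x2|->] //=; apply: inv.
Qed.

(** Otherwise 0 is the only double of order at most two, so the number of doubles is odd, and the
    group, twice as large, has order not divisible by 4. *)
Lemma involution_half i : i != 0 -> two_torsion = [set 0; i] ->
  (4 %| #|gT|)%N -> exists g, i = g *+ 2.
Proof.
move=> ni tE t4; have [/imsetP[g _ ->]|niD] := boolP (i \in doubles).
  by exists g.
have D0 : 0 \in doubles by apply/imsetP; exists 0; rewrite ?mul0rn.
have : ~~ odd #|doubles :\ 0|.
  apply: card_opp_closed.
    by move=> x; rewrite !inE oppr_eq0 => /andP[-> /opp_closed_doubles].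
  rewrite -setI_eq0 tE; apply/eqP/setP=> x; rewrite !inE.
  have [//|nx] := eqVneq x 0; have [->|] := eqVneq x i; last by rewrite andbF.
  by rewrite (negPf niD).
have := card_doubles; rewrite (cardsD1 0 doubles) D0 tE cards2 eq_sym ni => tc.
move: t4; rewrite tc; move: #|_ :\ _| => d; lia.
Qed.

(** * Setting vertices aside so that the rest of every class can be paired, and completing a partial
    weighting *)

Definition even_off (D : {set T}) :=
  forall v, ~~ odd #|even_class e v :\: D|.

Lemma even_off_mate D v : even_off D -> v \notin D ->
  exists u, [/\ u \notin D, u != v & even_walk e v u].
Proof.
move=> eD vD; have := eD v; rewrite (cardsD1 v) !inE vD even_walk_refl /=.
case: (set_0Vmem (even_class e v :\: D :\ v)) => [->|[u]]; first by rewrite cards0.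
by rewrite !inE => /and3P[nu uD vu] _; exists u.
Qed.

Lemma even_offU2 D u v : even_off D -> u \notin D -> v \notin D -> u != v ->
  even_walk e u v -> even_off (D :|: [set u; v]).
Proof.
move=> eD uD vD nuv uv z; have := eD z.
rewrite (cardsD1 u) (cardsD1 v (_ :\ u)) !inE uD vD eq_sym nuv /=.
rewrite (even_walk_sym e_sym z v) -(even_walk_left_trans e_sym uv).
rewrite (even_walk_sym e_sym u z) !oddD addbA addbb /=.
have -> // : even_class e z :\: (D :|: [set u; v]) = even_class e z :\: D :\ u :\ v.
by rewrite setUA -!setDDl.
Qed.

(** [V0] is already weighted from the stock [F0]; [S] takes doubles outside [F0], and all other
    vertices are paired inside their classes with what remains. Since [F0] contains [two_torsion],
    every remaining [x] differs from [- x]. *)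
Lemma irregular_extension (V0 S : {set T}) (F0 : {set gT}) w0 :
    two_torsion \subset F0 -> opp_closed F0 -> partial_weighting V0 F0 w0 ->
    [disjoint V0 & S] -> ~~ odd #|S| -> {in S, forall v, odd_walk e v v} ->
    (#|S| <= #|doubles :\: F0|)%N -> even_off (V0 :|: S) ->
    (#|~: V0| <= #|~: F0|)%N ->
  exists f : {set T} -> gT, irregular_labeling e f.
Proof.
move=> tF cF pw0 dS evS oddS leS eV leV.
have dF (P : {set gT}) : P \subset ~: F0 -> [disjoint P & two_torsion].
  by rewrite -disjoints_subset; apply: disjointWr.
have sub1 : doubles :\: F0 \subset ~: F0 by rewrite setDE subsetIr.
(* Any two vertices of [S] may be paired, even across components: each has an odd closed walk, which
   realizes a double there independently. *)
have [| | | | | | |w1 [F1 [sF1 cF1 cardF1] pw1]] :=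
    @paired_weighting [rel _ _ | true] S (doubles :\: F0).
- by [].
- by [].
- move=> v vS; have -> // : [set u in S | true] = S.
  by apply/setP=> u; rewrite inE andbT.
- move=> u v uS vS _ x; rewrite !inE => /andP[_ /imsetP[y _ ->]].
  by rewrite -mulNrn; apply: realizableD; apply: realizable_double; apply: oddS.
- by apply: opp_closedD => //; apply: opp_closed_doubles.
- exact: dF.
- exact: leS.
have sub2 : ~: F0 :\: F1 \subset ~: F0 by rewrite subsetDl.
have [| | | | | | |w2 [F2 [sF2 cF2 cardF2] pw2]] :=
    @paired_weighting (even_walk e) (~: (V0 :|: S)) (~: F0 :\: F1).
- exact: even_walk_refl.
- exact: even_walk_left_trans.
- move=> v _; have -> // : [set u in ~: (V0 :|: S) | even_walk e v u]
      = even_class e v :\: (V0 :|: S) by apply/setP=> u; rewrite !inE.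
- by move=> u v _ _ uv x _; apply: realizable_even.
- by apply: opp_closedD => //; apply: opp_closedC.
- exact: dF.
(* Both sides drop by the order of [S]: the vertices of [S] are settled, and as many weights are
   spent. *)
- rewrite cardsD (setIidPr (subset_trans sF1 sub1)) cardF1 setCU.
  rewrite -setDE cardsD (setIidPr _) ?leq_sub2r //.
  by rewrite -disjoints_subset disjoint_sym.
have d01 : [disjoint F0 & F1].
  by rewrite disjoint_sym disjoints_subset (subset_trans sF1).
have d2 : [disjoint F0 :|: F1 & F2].
  rewrite disjoint_sym disjoints_subset setCU -setDE.
  exact: subset_trans sF2 _.
have [] := partial_weightingU _ d2 (partial_weightingU dS d01 pw0 pw1) pw2.
  by rewrite -setI_eq0 setICr.
rewrite setUCr => -[f fE] inj _ _; exists f => u v.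
by rewrite !fE; apply: inj; rewrite inE.
Qed.

End Weights.

(** * Representatives of the classes of odd order *)

Section OddClasses.

Variables (T : finType) (e : rel T).
Hypothesis e_sym : symmetric e.
Hypothesis ge3 : forall C : {set T}, C \in components e -> 3 <= #|C|.
Hypothesis even_bip : forall C A B : {set T}, C \in components e ->
  bipartition e C A B -> ~~ odd #|A| /\ ~~ odd #|B|.

Definition odd_reps : {set T} :=
  [set v | roots (two_step e) v && odd #|even_class e v|].

Lemma mem_components v : [set y | connect e v y] \in components e.
Proof. exact: imset_f. Qed.

(** Without an odd closed walk the class would be a color class of a bipartite component, hence
    even. *)
Lemma odd_class_walk v : odd #|even_class e v| -> odd_walk e v v.
Proof.
apply: contraTT => /(even_class_bipartition e_sym) bip.
by case: (even_bip (mem_components v) bip).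
Qed.

(** An odd closed walk at [v] makes its class the whole component. *)
Lemma odd_class_ge3 v : odd #|even_class e v| -> 3 <= #|even_class e v|.
Proof.
move=> odv; have vv := odd_class_walk odv.
have -> : even_class e v = [set y | connect e v y]; last exact/ge3/mem_components.
apply/setP=> y; rewrite !inE; apply/idP/idP; first exact: even_walk_connect.
by case/connect_even_or_odd=> // vy; apply: odd_odd_walk vv vy.
Qed.

Lemma odd_reps_walk : {in odd_reps, forall v, odd_walk e v v}.
Proof. by move=> v; rewrite inE => /andP[_ /odd_class_walk]. Qed.

Lemma even_class_root u v :
  (u \in even_class e v) = (fingraph.root (two_step e) v == fingraph.root (two_step e) u).
Proof. by rewrite inE root_connect //; apply: even_walk_sym. Qed.

Lemma even_class_eq u v : u \in even_class e v -> even_class e u = even_class e v.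
Proof. by rewrite even_class_root => /eqP E; apply/setP=> x; rewrite !even_class_root E. Qed.

(** The right-hand side is a boolean read as 0 or 1: only the root of the class can be a
    representative. *)
Lemma even_class_odd_reps v : #|even_class e v :&: odd_reps| = odd #|even_class e v|.
Proof.
have csym : connect_sym (two_step e) by apply: even_walk_sym.
set r := fingraph.root (two_step e) v.
have rv : r \in even_class e v by rewrite even_class_root /r root_root.
have rE u : u \in even_class e v -> roots (two_step e) u = (u == r).
  by rewrite even_class_root /roots -/r => /eqP <-; rewrite eq_sym.
have [od|ev] := boolP (odd _).
  rewrite -[RHS](cards1 r); congr #|pred_of_set _|; apply/setP=> u.
  rewrite 2!inE [u \in odd_reps]inE; apply/andP/eqP=> [[uv]|->].
    by rewrite (rE u uv) => /andP[/eqP].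
  by rewrite rv (rE _ rv) eqxx (even_class_eq rv).
apply/eqP; rewrite cards_eq0; apply/eqP/setP=> u; rewrite in_setI [u \in odd_reps]inE in_set0.
by apply/negP=> /and3P[/even_class_eq-> _]; rewrite (negPf ev).
Qed.

Lemma even_off_odd_reps : even_off e odd_reps.
Proof.
move=> v; have := cardsID odd_reps (even_class e v).
rewrite even_class_odd_reps; move: #|_| #|_| => a b; lia.
Qed.

Lemma card_by_root (A : {set T}) :
  #|A| = \sum_(r | roots (two_step e) r) #|A :&: even_class e r|.
Proof.
have csym : connect_sym (two_step e) by apply: even_walk_sym.
rewrite -sum1_card (partition_big (fingraph.root (two_step e)) (roots (two_step e))) /=;
  last by move=> v _; apply: roots_root.
apply: eq_bigr => r /eqP rr; rewrite sum1_card; apply: eq_card => x.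
by rewrite [LHS]inE in_setI even_class_root rr eq_sym.
Qed.

(** Without the representatives every class is even, so their complement is even. *)
Lemma odd_card_odd_reps : odd #|odd_reps| = odd #|T|.
Proof.
have ev : ~~ odd #|~: odd_reps|.
  rewrite card_by_root; elim/big_ind: _ => // [a b|r _]; first by rewrite oddD; case: odd.
  by rewrite setIC -setDE; apply: even_off_odd_reps.
by have := cardsC odd_reps; move: ev; move: #|~: _| #|odd_reps| => a b; lia.
Qed.

(** Each representative accounts for a class of at least three vertices. *)
Lemma card_odd_reps_le : 3 * #|odd_reps| <= #|T|.
Proof.
rewrite -cardsT (card_by_root setT) mulnC -sum_nat_const.
rewrite [leqRHS](bigID [pred r | odd #|even_class e r|]) /=.
apply: leq_trans (leq_addr _ _).
rewrite (eq_bigl (fun r => roots (two_step e) r && odd #|even_class e r|));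
  last by move=> r; rewrite inE.
by apply: leq_sum => r /andP[_ /odd_class_ge3]; rewrite setTI.
Qed.

End OddClasses.

(** * Four vertices of a bipartite component in the tight case *)

Lemma uniq_map_inj (A B : eqType) (f : A -> B) (s : seq A) :
  uniq (map f s) -> {in s &, injective f}.
Proof.
elim: s => //= a s IH /andP[na us] x y.
rewrite !inE => /predU1P[->|xs] /predU1P[->|ys] E //; last exact: IH.
  by rewrite E map_f in na.
by rewrite -E map_f in na.
Qed.

(** The hypotheses say that [g] has order four, so 0, [g], 2[g] and -[g] are distinct. *)
Lemma tight_bipartite_weighting (T : finType) (e : rel T) (gT : finZmodType)
    (g : gT) (v u b c : T) :
    symmetric e -> irreflexive e -> (g *+ 2 != 0)%R -> (g *+ 2 *+ 2 = 0)%R ->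
    uniq [:: v; u; b; c] -> even_walk e v u -> e v b -> even_walk e b c ->
  exists w, partial_weighting e ([set v; u] :|: [set b; c])
    ([set 0; g *+ 2] :|: [set g; - g])%R w.
Proof.
move=> e_sym e_irr g2 g4; rewrite /= !inE !negb_or.
case/and4P=> /and3P[vu vb vc] /andP[ub uc] bc _ wvu evb wbc.
have wub : odd_walk e u b.
  by apply: even_odd_walk (edge_odd_walk evb) => //; rewrite (even_walk_sym e_sym).
(* The odd walk from [u] to [b] adds [g] at both ends, the even walk from [b] to [c] adds [g] and
   [- g]; [v] keeps 0 and [b] collects 2[g]. *)
pose w := (point_weight u g + point_weight b g
  + (point_weight b g + point_weight c (- g)))%R.
have wv : w v = 0%R by rewrite !ffunE (negPf vu) (negPf vb) (negPf vc) !addr0.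
have wu : w u = g by rewrite !ffunE eqxx (negPf ub) (negPf uc) !addr0.
have wb : w b = (g *+ 2)%R.
  by rewrite !ffunE eqxx eq_sym (negPf ub) (negPf bc) add0r addr0 mulr2n.
have wc : w c = (- g)%R.
  by rewrite !ffunE eqxx !(eq_sym c) (negPf uc) (negPf bc) !add0r.
have g0 : (g != 0)%R by apply: contra_neq g2 => ->; rewrite mul0rn.
have gN : (g != - g)%R by rewrite -two_torsionE inE.
have g2g : (g *+ 2 != g)%R by rewrite mulr2n -subr_eq0 addrK.
have g2N : (g *+ 2 != - g)%R.
  apply: contra_neq g0 => E; have := g4.
  by rewrite E mulNrn => /eqP; rewrite oppr_eq0 (negPf g2).
have inj : uniq [seq w x | x <- [:: v; u; b; c]].
  rewrite /= wv wu wb wc !inE !negb_or !(eq_sym 0%R) oppr_eq0 g0 g2 gN g2N.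
  by rewrite eq_sym g2g.
exists w; split.
- by apply: realizableD; [apply: realizable_odd | apply: realizable_even].
- have sub x : x \in [set v; u] :|: [set b; c] -> x \in [:: v; u; b; c].
    by rewrite !inE -!orbA.
  by move=> x y /sub xs /sub ys; apply: (uniq_map_inj inj).
- by move=> x; rewrite !inE => /orP[] /orP[] /eqP->;
    rewrite ?wv ?wu ?wb ?wc eqxx ?orbT.
- move=> x; rewrite !inE !negb_or => /andP[/andP[xv xu] /andP[xb xc]].
  by rewrite !ffunE (negPf xu) (negPf xb) (negPf xc) !addr0.
Qed.

(** * Case analysis and counting of weights *)

Theorem theorem2p3 (T : finType) (e : rel T)
    (He : simple_graph e)
    (Hdisc : disconnected_graph e)
    (Hord : forall C : {set T}, C \in components e -> 3 <= #|C|)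
    (Hbip : forall C A B : {set T}, C \in components e ->
       bipartition e C A B -> ~~ odd #|A| /\ ~~ odd #|B|)
    (t : nat) (Ht : order_bound #|T| <= t)
    (gT : finZmodType) (HgT : #|gT| = t)
    (Hinv : at_most_one_involution gT) :
  exists f : {set T} -> gT, irregular_labeling e f.
Proof.
have [e_sym e_irr] := He.
have le_nt : #|T| <= t by move: Ht; rewrite /order_bound; case: eqP; lia.
(* If n is 2 modulo 4, the bound n+1 rules out equality. *)
have ne_nt : #|T| = t -> odd t || (4 %| t).
  by move: Ht; rewrite /order_bound; case: eqP; lia.
have oddS := odd_card_odd_reps e_sym.
have leS := card_odd_reps_le e_sym Hord Hbip.
have S_walk := odd_reps_walk e_sym Hbip.
have S_off := even_off_odd_reps e_sym.
move: oddS leS S_walk S_off; move: (odd_reps e) => S oddS leS S_walk S_off.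
have cDI := card_doubles gT; rewrite HgT in cDI.
have evCI : ~~ odd #|~: two_torsion gT|.
  apply: card_opp_closed; first exact/opp_closedC/opp_closed_two_torsion.
  by rewrite disjoints_subset.
have cCI := cardsC (two_torsion gT); rewrite HgT in cCI.
have cI : #|two_torsion gT| = 1 \/ #|two_torsion gT| = 2.
  case: (two_torsion_cases Hinv) => [->|[i i0 ->]]; first by left; rewrite cards1.
  by right; rewrite cards2 eq_sym i0.
have cDmI : #|doubles gT| - #|two_torsion gT| <= #|doubles gT :\: two_torsion gT|.
  by rewrite cardsD leq_sub2l // subset_leq_card // subsetIr.
have cV (V : {set T}) := cardsC V.
have I_opp := @opp_closed_two_torsion gT.
(* Outside the tight case only [two_torsion] is reserved. If [S] is odd, one of its vertices takes
   the weight 0; parity of n and t then makes the remaining weights suffice. *)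
have [/andP[/eqP nt t4]|loose] := boolP ((#|T| == t) && (4 %| t)); last first.
  have [Sodd|Sev] := boolP (odd #|S|).
    have [s sS] : exists s, s \in S by apply/card_gt0P; case: #|S| Sodd.
    have cSs := cardsD1 s S; rewrite sS in cSs.
    apply: (@irregular_extension _ _ _ e_sym e_irr [set s] (S :\ s)
      (two_torsion gT) 0%R) => //.
    - split; [exact: realizable0 | | |].
      + by move=> x y /set1P-> /set1P->.
      + by move=> x _; rewrite ffunE zero_two_torsion.
      + by move=> x _; rewrite ffunE.
    - by rewrite disjoints_subset sub1set !inE eqxx.
    - by lia.
    - by move=> v /setD1P[_]; apply: S_walk.
    - apply: leq_trans cDmI.
      by case: cI cDI cCI => ->; lia.
    - by rewrite setD1K.
    - by have := cV [set s]; rewrite cards1; case: cI cCI => ->; lia.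
  apply: (@irregular_extension _ _ _ e_sym e_irr set0 S (two_torsion gT) 0%R) => //.
  - exact: partial_weighting0.
  - by rewrite disjoint_sym disjoints_subset setC0.
  - apply: leq_trans cDmI.
    by case: cI cDI cCI => ->; lia.
  - by rewrite set0U.
  - by have := cV set0; rewrite cards0; case: cI cCI => ->; lia.
(* Tight case. A trivial [two_torsion] would force t to be odd. *)
have [iE|[i i0 iE]] := two_torsion_cases Hinv.
  by move: evCI cCI; rewrite iE cards1; lia.
have [g gE] : exists g, i = (g *+ 2)%R by apply: involution_half; rewrite ?HgT.
have cI2 : #|two_torsion gT| = 2 by rewrite iE cards2 eq_sym i0.
have t0 : 0 < t by rewrite -HgT; apply/card_gt0P; exists 0%R.
have [/existsP[z zz]|/existsPn nodd] := boolP [exists v, odd_walk e v v].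
  (* Two vertices with odd closed walks are needed for 0 and [i]. If [S] is nonempty it has at least
     two, being even; if it is empty, [z] and a mate in its class serve. *)
  have [S0 [S0_off S0_walk S0_ev S0_gt1 S0_le]] : exists S0 : {set T},
      [/\ even_off e S0, {in S0, forall v, odd_walk e v v}, ~~ odd #|S0|,
          1 < #|S0| & #|S0| <= #|doubles gT|].
    have [S0|[s sS]] := set_0Vmem S; last first.
      have : 0 < #|S| by apply/card_gt0P; exists s.
      by exists S; split=> //; lia.
    have [|u [_ uz zu]] := even_off_mate S_off (_ : z \notin S).
      by rewrite S0 inE.
    move: S_off; rewrite S0 => off0.
    exists (set0 :|: [set z; u]); split.
    - by apply: even_offU2; rewrite ?inE 1?eq_sym.
    - move=> x; rewrite set0U !inE => /orP[]/eqP-> //.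
      apply: odd_even_walk (zu); apply: even_odd_walk (zz) => //.
      by rewrite (even_walk_sym e_sym).
    - by rewrite set0U cards2 eq_sym uz.
    - by rewrite set0U cards2 eq_sym uz.
    - by rewrite set0U cards2 eq_sym uz; lia.
  have [u [v [uS vS nuv]]] := card_gt1P S0_gt1.
  have sub : [set u; v] \subset S0 by rewrite subUset !sub1set uS.
  (* [u] keeps the weight 0, and [v] gets [i], a double, from its odd closed walk. *)
  apply: (@irregular_extension _ _ _ e_sym e_irr [set u; v] (S0 :\: [set u; v])
    (two_torsion gT) (point_weight v i)) => //.
  - rewrite iE; split.
    + by rewrite gE; apply/realizable_double/S0_walk.
    + move=> x y; rewrite !inE !ffunE => /orP[]/eqP-> /orP[]/eqP->;
        rewrite ?eqxx ?(negPf nuv) // => E; by case/eqP: i0.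
    + by move=> x _; rewrite !inE ffunE; case: (x == v); rewrite eqxx ?orbT.
    + by move=> x; rewrite !inE ffunE negb_or => /andP[_ /negPf->].
  - by rewrite disjoint_sym disjoints_subset setDE subsetIr.
  - by rewrite cardsD (setIidPr sub) cards2 nuv; lia.
  - by move=> x /setDP[xS _]; apply: S0_walk.
  - by apply: leq_trans cDmI; rewrite cardsD (setIidPr sub) cards2 nuv cI2; lia.
  - by rewrite -{1}(setIidPr sub) setID.
  - by have := cV [set u; v]; rewrite cards2 nuv; lia.
have off0 : even_off e set0.
  suff <- : S = set0 by [].
  by apply/setP=> x; rewrite inE; apply/negP=> /S_walk; apply/negP.
have [v _] : exists v, v \in T by apply/card_gt0P; rewrite nt.
have [|u [_ uv vu]] := even_off_mate off0 (_ : v \notin set0); first by rewrite inE.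
(* The even walk from [v] to [u] is nontrivial as [u] differs from [v]; its first inner vertex is a
   neighbor. *)
have [b vb] : exists b, e v b.
  case/connectP: vu uv => -[/= _ ->|a p /= /andP[/existsP[m /andP[vm _]] _] _ _].
    by rewrite eqxx.
  by exists m.
have off1 := even_offU2 e_sym off0 _ _ _ vu.
move: off1; rewrite set0U !inE eq_sym => /(_ isT isT uv) off1.
have bv : b != v by apply: contraTneq vb => ->; rewrite e_irr.
have bu : b != u.
  apply: contra (nodd v) => /eqP bu; rewrite bu in vb.
  by apply: odd_even_walk (edge_odd_walk vb) _; rewrite (even_walk_sym e_sym).
have bD : b \notin [set v; u] by rewrite !inE negb_or bv.
(* The mate of [b] is sought off [v] and [u], whose removal keeps all classes even. *)
have [c [cD cb bc]] := even_off_mate off1 bD.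
have off2 := even_offU2 e_sym off1 bD cD _ bc.
rewrite eq_sym in off2; move: off2 => /(_ cb) off2.
have un : uniq [:: v; u; b; c].
  move: cD; rewrite /= !inE !negb_or => /andP[cv cu].
  rewrite (eq_sym v u) uv (eq_sym v b) bv (eq_sym v) cv.
  by rewrite (eq_sym u b) bu (eq_sym u) cu (eq_sym b) cb.
have g2 : (g *+ 2 != 0)%R by rewrite -gE.
have g4 : (g *+ 2 *+ 2 = 0)%R.
  have : i \in two_torsion gT by rewrite iE !inE eqxx orbT.
  by rewrite inE gE => /eqP.
have [w pw] := tight_bipartite_weighting e_sym e_irr g2 g4 un vu vb bc.
apply: (irregular_extension e_sym e_irr (S := set0) _ _ pw).
- by rewrite iE gE subsetUl.
- move=> x; rewrite -gE -iE in_setU => /orP[/I_opp xI|]; first by rewrite in_setU xI.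
  by rewrite !inE => /orP[] /eqP->; rewrite ?opprK eqxx ?orbT.
- by rewrite disjoint_sym disjoints_subset sub0set.
- by rewrite cards0.
- by move=> x; rewrite inE.
- by rewrite cards0.
- by rewrite setU0.
(* An upper bound suffices: exactly four vertices are settled and n = t, so enough weights
   remain. *)
have cF : #|[set 0; g *+ 2] :|: [set g; - g]|%R <= 4.
  apply: leq_trans (leq_card_setU _ _) _; rewrite !cards2; by do 2 case: eqP.
have cV4 : #|[set v; u] :|: [set b; c]| = 4.
  by rewrite -setUA -[RHS]/(size [:: v; u; b; c]) -(card_uniqP un);
    apply: eq_card => x; rewrite !inE -?orbA.
have := cV ([set v; u] :|: [set b; c]).
rewrite cV4 nt -HgT -(cardsC ([set 0; g *+ 2] :|: [set g; - g])%R) => E.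
by rewrite -(leq_add2l 4) E leq_add2r.
Qed.
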